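(* Let $3\le n\le 9$. Let $m,m'\neq 0,\pm 1$ be square-free integers with $m\equiv m'\pmod{n^2}$, and let $\vartheta=\sqrt[n]{m}$, $\gamma=\sqrt[n]{m'}$. Then the integral bases of $\mathbb{Q}(\vartheta)$ and $\mathbb{Q}(\gamma)$ have the same structure: for integers $a_{j,i}$ and positive integers $q_j$ ($1\le j\le n$, $0\le i\le n-1$), the elements $\frac{1}{q_j}\sum_{i=0}^{n-1}a_{j,i}\vartheta^i$ ($1\le j\le n$) form an integral basis of $\mathbb{Q}(\vartheta)$ if and only if the elements $\frac{1}{q_j}\sum_{i=0}^{n-1}a_{j,i}\gamma^i$ ($1\le j\le n$) form an integral basis of $\mathbb{Q}(\gamma)$. That is, the structure of the integral bases of $\mathbb{Q}(\sqrt[n]{m})$ is periodic in $m$ modulo $n^2$.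
   Context: An integral basis of a number field $L$ is a $\mathbb{Z}$-basis of its ring of integers. *)

(* Defs.v *)
From HB Require Import structures.
From mathcomp Require Import all_boot all_order all_algebra all_field.

Set Implicit Arguments.
Unset Strict Implicit.
Unset Printing Implicit Defensive.

Import GRing.Theory.
Local Open Scope ring_scope.

Definition squarefreez (m : int) : Prop :=
  forall d : int, (d ^+ 2 %| m)%Z -> d \is a GRing.unit.

(* A number field is a finite extension of rat, i.e., a fieldExtType rat. *)
Definition ring_of_integers (L : fieldExtType rat) (x : L) : Prop :=
  integralOver (intr : int -> L) x.

Definition integral_basis (L : fieldExtType rat) (k : nat) (w : 'I_k -> L) :
    Prop :=
  [/\ forall j, ring_of_integers (w j),
      forall c : 'I_k -> int,
        \sum_(j < k) (c j)%:~R * w j = 0 -> forall j, c j = 0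
    & forall x : L, ring_of_integers x ->
        exists c : 'I_k -> int, x = \sum_(j < k) (c j)%:~R * w j].

(* Row j is the element (1 / q_j) * sum_i a_(j,i) t^i; both indices are shifted
   to range over {0, ..., n-1}. *)
Definition basis_candidate (L : fieldExtType rat) (n : nat)
    (a : 'I_n -> 'I_n -> int) (q : 'I_n -> nat) (t : L) (j : 'I_n) : L :=
  (q j)%:R^-1 * \sum_(i < n) (a j i)%:~R * t ^+ i.

(* Main.v *)
(** Write [r] and [s] for complex roots of [X^n - m] and [X^n - m'].  As these
    binomials are irreducible (Eisenstein), the theorem says that, for [f] in
    [Q[X]] of degree less than [n], [f(r)] is an algebraic integer iff [f(s)]
    is.  Taking traces, then using that [m] is square-free, [n f] has integer
    coefficients as soon as [f(r)] is integral, so only [F(r) / p^k] matters,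
    with [F] in [Z[X]] and [p^k] the exact power of a prime [p] dividing [n].
    - If [p] divides [m], integrality of [F(r) / p^k] forces [p^k] to divide [F].
    - If not, and [p] divides ['C(n, 2)], Hensel lifting gives [v = 1 mod p^k]
      with [m' v^n] as close to [m] as desired [p]-adically; then [v s] is close
      enough to [r] for [F(v s) / p^k] to be integral, and it differs from
      [F(s) / p^k] by an element of [Z[s]].
    - Otherwise [p^k = 2] and [n = 2 n'] with [n'] odd.  Writing
      [F = E(X^2) + X O(X^2)], integrality of [F(r) / 2] means that
      [E^2 - X O^2] vanishes modulo [4] and [X^n' - m], which only depends on
      [m] modulo [4]. *)
Require Import Defs.
From mathcomp Require Import all_boot all_order all_algebra all_field.
From mathcomp Require Import ring zify.

Set Implicit Arguments.
Unset Strict Implicit.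
Unset Printing Implicit Defensive.

Import Order.TTheory GRing.Theory Num.Theory.
Local Open Scope ring_scope.

(** * Square-free radicands and irreducible binomials *)

Lemma unitzE (x : int) : (x \is a GRing.unit) = (`|x| == 1)%N.
Proof. by rewrite [LHS]unfold_in /=; lia. Qed.

(** Being square-free already excludes [0], as [0] is not a unit; excluding units removes [1] and
    [-1]. *)
Definition radicand (m : int) : Prop :=
  squarefreez m /\ m \isn't a GRing.unit.

Lemma squarefreez_neq0 m : squarefreez m -> m != 0.
Proof.
move=> sqf; apply/eqP => m0.
by have := sqf 0; rewrite m0 dvdz0 => /(_ isT).
Qed.

Lemma radicand_neq0 m : radicand m -> m != 0.
Proof. by case=> /squarefreez_neq0. Qed.

Lemma squarefreez_prime m p :
  squarefreez m -> prime p -> ~~ ((p%:Z) ^+ 2 %| m)%Z.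
Proof.
move=> sqf p_pr; apply/negP => /sqf; rewrite unitzE.
by rewrite absz_nat; case: p p_pr => [|[|p]].
Qed.

Lemma radicand_prime m : radicand m -> exists2 p, prime p & (p %| m)%Z.
Proof.
move=> mP; case: (mP) => _ mU; exists (pdiv `|m|); last first.
  by rewrite dvdzE absz_nat pdiv_dvd.
apply: pdiv_prime; move: (radicand_neq0 mP) mU.
by rewrite unitzE -absz_eq0; case: `|m|%N => [|[|]].
Qed.

(** Write [m = e * gcd(m, a)]. A prime dividing [e] divides [m], hence [a], hence the gcd as well,
    so its square would divide [m]. *)
Lemma squarefreez_dvdX m a k :
  squarefreez m -> (m %| a ^+ k)%Z -> (m %| a)%Z.
Proof.
move=> sqf m_ak; have m0 := squarefreez_neq0 sqf.
have [e Dm] := dvdzP (dvdz_gcdl m a).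
suff e1 : `|e|%N = 1%N.
  by rewrite Dm; apply: dvdz_trans (dvdz_gcdr m a); rewrite dvdzE abszM e1 mul1n.
apply/eqP/negPn/negP => e1.
have e0 : (0 < `|e|)%N.
  by rewrite absz_gt0; apply: contraNneq m0 => e0; rewrite Dm e0 mul0r.
have p_pr : prime (pdiv `|e|) by apply: pdiv_prime; lia.
have pe : (pdiv `|e| %| e)%Z by rewrite dvdzE absz_nat pdiv_dvd.
have pm : (pdiv `|e| %| m)%Z by rewrite Dm dvdz_mulr.
have pa : (pdiv `|e| %| a)%Z.
  move: (dvdz_trans pm m_ak); rewrite !dvdzE abszX absz_nat.
  by rewrite Euclid_dvdX // => /andP[].
case/negP: (squarefreez_prime sqf p_pr).
by rewrite expr2 [X in (_ %| X)%Z]Dm dvdz_mul // dvdz_gcd pm.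
Qed.

Lemma irreducible_binomial n m : (0 < n)%N -> radicand m ->
  irreducible_poly ('X^n - m%:~R%:P : {poly rat}).
Proof.
move=> n0 mP; have [p p_pr pm] := radicand_prime mP.
have -> : 'X^n - m%:~R%:P = map_poly intr ('X^n - m%:P) :> {poly rat}.
  by rewrite rmorphB /= map_polyXn map_polyC.
apply/irreducible_rat_int/(@eisenstein_crit p) => //.
- by rewrite size_XnsubC //; case: n n0.
- by rewrite (monicP (monicXnsubC _ n0)) dvdzE; case: p p_pr {pm} => [|[|]].
- rewrite coefB coefXn coefC eqxx eq_sym eqn0Ngt n0 sub0r rpredN.
  by apply: squarefreez_prime => //; case: mP.
move=> i; rewrite size_XnsubC //= => lt_in.
rewrite coefB coefXn coefC ltn_eqF // sub0r rpredN.
by case: eqP => // _; apply: dvdz0.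
Qed.

Lemma root_binomial (K : fieldType) (iota : {rmorphism rat -> K}) n m (t : K) :
  t ^+ n = m%:~R -> root (map_poly iota ('X^n - m%:~R%:P)) t.
Proof.
move=> tn; rewrite /root rmorphB /= map_polyXn map_polyC /= rmorph_int.
by rewrite !hornerE tn subrr.
Qed.

Lemma root_binomial_dvdp (K : fieldType) (iota : {rmorphism rat -> K}) n m
    (t : K) f :
    (0 < n)%N -> radicand m -> t ^+ n = m%:~R ->
  root (map_poly iota f) t = ('X^n - m%:~R%:P %| f).
Proof.
move=> n0 mP tn; have irr := irreducible_binomial n0 mP.
have rt := root_binomial iota tn.
apply/idP/idP => [ft | /dvdpP[h ->]]; last first.
  by rewrite rmorphM rootM rt orbT.
apply/negPn/negP; rewrite -irreducible_poly_coprime // => cop.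
move: cop; rewrite -(coprimep_map iota) => /coprimep_root/(_ rt).
by rewrite (rootP ft) eqxx.
Qed.

(** A monic [g] kills [f(t)] iff [X^n - m] divides [g \Po f] over the rationals, a condition that
    involves neither the field nor the chosen root. This serves both to conjugate roots and to pass
    between number fields and [algC]. *)
Lemma integral_horner_binomial (K K' : fieldType)
    (iota : {rmorphism rat -> K}) (iota' : {rmorphism rat -> K'}) n m
    (t : K) (t' : K') f :
    (0 < n)%N -> radicand m -> t ^+ n = m%:~R -> t' ^+ n = m%:~R ->
  integralOver intr (map_poly iota f).[t] ->
  integralOver intr (map_poly iota' f).[t'].
Proof.
move=> n0 mP tn t'n [g g_mon gt0]; exists g => //.
have E (F : fieldType) (j : {rmorphism rat -> F}) (s : F) :
    root (map_poly intr g) (map_poly j f).[s]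
    = root (map_poly j ((map_poly intr g) \Po f)) s.
  rewrite /root map_comp_poly horner_comp -map_poly_comp /=.
  by congr (_.[_] == 0); apply: eq_map_poly => i /=; rewrite rmorph_int.
by move: gt0; rewrite !E !(root_binomial_dvdp _ _ n0 mP).
Qed.

(** * Algebraic integers, traces and denominators *)

Lemma AintP (x : algC) : x \in Aint <-> integralOver (intr : int -> algC) x.
Proof.
split=> [|[p p_mon px]].
  rewrite unfold_in => /floorpP[p Dp].
  exists p; last by rewrite -Dp root_minCpoly.
  apply/eqP/(@intr_inj algC).
  rewrite -lead_coef_map_inj // -?Dp; last exact: intr_inj.
  exact/monicP/minCpoly_monic.
apply: root_monic_Aint px _ _; first exact: monic_map.
by apply/polyOverP => i; rewrite coef_map /= intr_int.
Qed.

Lemma Aint_expn_int n (m : int) (x : algC) :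
  (0 < n)%N -> x ^+ n = m%:~R -> x \in Aint.
Proof.
move=> n0 xn; apply: (@root_monic_Aint ('X^n - m%:~R%:P)).
- by rewrite /root !hornerE xn subrr.
- exact: monicXnsubC.
apply/polyOverP=> i; rewrite coefB coefXn coefC rpredB ?rpred_nat //.
by case: ifP; rewrite ?rpred0 ?intr_int.
Qed.

Lemma Aint_horner_int (F : {poly int}) (x : algC) :
  x \in Aint -> (map_poly intr F).[x] \in Aint.
Proof.
move=> xA; apply: rpred_horner => //.
by apply/polyOverP => i; rewrite coef_map /= Aint_int.
Qed.

Lemma map_intr_ratr (F : {poly int}) :
  map_poly ratr (map_poly intr F : {poly rat}) = map_poly intr F :> {poly algC}.
Proof.
by rewrite -map_poly_comp; apply: eq_map_poly => x /=; rewrite rmorph_int.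
Qed.

Lemma Aint_ratr (q : rat) : (ratr q : algC) \in Aint -> q \is a Num.int.
Proof.
move=> qA; have /intrP[z] := Cint_rat_Aint (Crat_rat q) qA.
by rewrite -ratr_int => /fmorph_inj ->; apply: intr_int.
Qed.

Lemma Aint_conjugate n m (r s : algC) (f : {poly rat}) :
    (0 < n)%N -> radicand m -> r ^+ n = m%:~R -> s ^+ n = m%:~R ->
  (map_poly ratr f).[r] \in Aint -> (map_poly ratr f).[s] \in Aint.
Proof.
move=> n0 mP rn sn /AintP fr; apply/AintP.
exact: integral_horner_binomial n0 mP rn sn fr.
Qed.

Lemma sum_prim_root_exp (K : fieldType) n (z : K) e : n.-primitive_root z ->
  \sum_(j < n) z ^+ (j * e) = if (n %| e)%N then n%:R else 0.
Proof.
move=> z_prim; under eq_bigr => j _ do rewrite mulnC exprM.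
case: ifPn => [n_e | nn_e].
  have -> : z ^+ e = 1 by apply/eqP; rewrite -(prim_order_dvd z_prim).
  by under eq_bigr => j _ do rewrite expr1n; rewrite sumr_const card_ord.
have : (z ^+ e) ^+ n - 1 = 0.
  by rewrite exprAC (prim_expr_order z_prim) expr1n subrr.
move/eqP; rewrite subrX1 mulf_eq0 subr_eq0 -(prim_order_dvd z_prim).
by rewrite (negPf nn_e) => /eqP.
Qed.

(* The trace of [f(r) * r^(n - i)] is [n m f_i]. *)
Lemma int_trace_binomial n m (r : algC) (f : {poly rat}) i :
    radicand m -> r ^+ n = m%:~R -> (size f <= n)%N -> (i < n)%N ->
    (map_poly ratr f).[r] \in Aint ->
  n%:R * m%:~R * f`_i \is a Num.int.
Proof.
move=> mP rn szf lt_in fA; have n0 : (0 < n)%N by apply: leq_ltn_trans lt_in.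
have [z z_prim] := C_prim_root_exists n0.
have conj_n j : (z ^+ j * r) ^+ n = m%:~R.
  by rewrite exprMn exprAC (prim_expr_order z_prim) expr1n mul1r.
apply: Aint_ratr; rewrite !rmorphM /= rmorph_nat rmorph_int.
suff <- : \sum_(j < n) (map_poly ratr f).[z ^+ j * r] * (z ^+ j * r) ^+ (n - i)
    = n%:R * m%:~R * ratr f`_i :> algC.
  apply: rpred_sum => j _; rewrite rpredM ?rpredX //.
    exact: Aint_conjugate n0 mP rn (conj_n j) fA.
  exact: Aint_expn_int n0 (conj_n j).
have szf' : (size (map_poly ratr f : {poly algC}) <= n)%N by rewrite size_map_poly.
under eq_bigr => j _ do rewrite (horner_coef_wide _ szf') mulr_suml.
rewrite exchange_big /= (bigD1 (Ordinal lt_in)) //= [X in _ + X]big1 ?addr0.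
  under eq_bigr => j _ do
    rewrite -mulrA -exprD subnKC ?(ltnW lt_in) // conj_n coef_map /=.
  by rewrite sumr_const card_ord -mulr_natl; ring.
move=> l; rewrite -val_eqE /= => ne_li.
under eq_bigr => j _ do
  rewrite -mulrA -exprD exprMn -exprM mulrCA.
rewrite -mulr_suml sum_prim_root_exp // ifN ?mul0r //.
(* The exponent [l + (n - i)] lies strictly between [0] and [2n] and differs from [n]. *)
apply/negP => /dvdnP[k Dk]; have lt_ln := ltn_ord l.
by case: k Dk => [|[|k]]; move/eqP: ne_li; lia.
Qed.

(* If [m] divides [g_j] for all [j < i], then multiplying [g(r) / m] by
   [r^(n-1-i)] shows that [g_i r^(n-1) / m] is integral, hence so is its [n]-th
   power [g_i^n / m]. *)
Lemma dvdz_coef_radicand n m (r : algC) (g : {poly int}) i :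
    radicand m -> r ^+ n = m%:~R -> (size g <= n)%N ->
    (map_poly intr g).[r] / m%:~R \in Aint ->
  (m %| g`_i)%Z.
Proof.
move=> mP rn szg gA; have m0 : m%:~R != 0 :> algC.
  by rewrite intr_eq0 radicand_neq0.
have [le_ni|lt_in] := leqP n i; first by rewrite nth_default ?dvdz0 ?(leq_trans szg).
have n0 : (0 < n)%N by apply: leq_ltn_trans lt_in.
have rA : r \in Aint := Aint_expn_int n0 rn.
elim/ltn_ind: i lt_in => i IH lt_in.
have tA : (g`_i)%:~R * r ^+ n.-1 / m%:~R \in Aint.
  have: (map_poly intr g).[r] / m%:~R * r ^+ (n.-1 - i) \in Aint.
    by rewrite rpredM ?rpredX.
  have szg' : (size (map_poly intr g : {poly algC}) <= n)%N.
    exact: leq_trans (size_poly _ _) szg.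
  rewrite (horner_coef_wide _ szg') mulrAC mulr_suml mulr_suml.
  rewrite (bigD1 (Ordinal lt_in)) //= coef_map /= -(mulrA _ (r ^+ i)) -exprD.
  rewrite subnKC; last by lia.
  (* The other terms are integral: for [j < i] since [m] divides [g_j], for [j > i] since a factor
     [r^n = m] cancels the denominator. *)
  rewrite rpredDr //; apply: rpred_sum => j; rewrite -val_eqE /= => ne_ji.
  rewrite coef_map /= -(mulrA _ (r ^+ j)) -exprD; have [lt_ji|le_ij] := ltnP j i.
    have /dvdzP[c ->] := IH _ lt_ji (ltn_ord j).
    by rewrite rmorphM /= mulrAC mulfK // rpredM ?rpredX ?Aint_int.
  have -> : (j + (n.-1 - i) = n + (j - i).-1)%N.
    by move: le_ij; move/eqP: ne_ji; lia.
  by rewrite exprD rn mulrCA mulrC mulKf // rpredM ?rpredX ?Aint_int.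
have /rpredX : (g`_i)%:~R * r ^+ n.-1 / m%:~R \in Aint := tA.
move=> /(_ n); rewrite 2!exprMn exprAC rn.
have -> : (g`_i)%:~R ^+ n * m%:~R ^+ n.-1 * m%:~R^-1 ^+ n
    = ratr ((g`_i ^+ n)%:~R / m%:~R) :> algC.
  rewrite rmorphM /= fmorphV !rmorph_int rmorphXn /= -{3}(prednK n0).
  rewrite exprVn exprS invfM.
  by rewrite -mulrA [X in _ * X]mulrC -mulrA mulVf ?mulr1 // expf_neq0.
move/Aint_ratr/intrP=> [c Dc]; apply: (@squarefreez_dvdX _ _ n); first by case: mP.
apply/dvdzP; exists c; apply: (@intr_inj rat).
by rewrite rmorphM /= -Dc divfK // intr_eq0 radicand_neq0.
Qed.

(** Traces make [G = n m f] integral; then [G(r) / m = n f(r)] is an algebraic integer, so [m]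
    divides every coefficient of [G]. *)
Lemma Aint_binomial_denominator n m (r : algC) (f : {poly rat}) :
    (0 < n)%N -> radicand m -> r ^+ n = m%:~R -> (size f <= n)%N ->
    (map_poly ratr f).[r] \in Aint ->
  n%:R *: f \is a polyOver Num.int.
Proof.
move=> n0 mP rn szf fA; have m0 := radicand_neq0 mP.
have /floorpP[G DG] : (n%:R * m%:~R) *: f \is a polyOver Num.int.
  apply/polyOverP => i; rewrite coefZ; have [lt_in|le_ni] := ltnP i n.
    exact: int_trace_binomial mP rn szf lt_in fA.
  by rewrite nth_default ?mulr0 ?(leq_trans szf).
have szG : (size G <= n)%N.
  rewrite -(size_map_inj_poly (@intr_inj rat)) ?rmorph0 // -DG.
  exact: leq_trans (size_scale_leq _ _) szf.
have GA : (map_poly intr G).[r] / m%:~R \in Aint.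
  rewrite -map_intr_ratr -DG map_polyZ hornerZ rmorphM /= rmorph_nat rmorph_int.
  rewrite mulrAC mulfK.
    by rewrite rpredM // rpred_nat.
  by rewrite intr_eq0.
apply/polyOverP => i; have /dvdzP[c Dc] := dvdz_coef_radicand i mP rn szG GA.
apply/intrP; exists c; move/(congr1 (fun p : {poly rat} => p`_i)): DG.
rewrite !coefZ coef_map /= Dc rmorphM /= mulrAC => /mulIf; apply.
by rewrite intr_eq0.
Qed.

(** * Hensel lifting and perturbation of the radicand *)

Lemma expr1D_cubic (y : int) n : exists z,
  (1 + y) ^+ n = 1 + n%:R * y + 'C(n, 2)%:R * y ^+ 2 + z * y ^+ 3.
Proof.
elim: n => [|n [z IH]]; first by exists 0; rewrite expr0 bin0n /=; ring.
exists (z * (1 + y) + 'C(n, 2)%:R).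
by rewrite exprS IH binS bin1 natrD -natr1; ring.
Qed.

(* For [y = p^(N+k) s] the cubic and the quadratic terms of [(1 + y)^n] vanish
   modulo [p^(N+2k+1)], the latter because [p] divides ['C(n, 2)]. *)
Lemma expn_lift p k n' n (a b : int) N :
    prime p -> (0 < k)%N -> n = (p ^ k * n')%N -> ~~ (p %| n')%N ->
    (p %| 'C(n, 2))%N -> ~~ (p %| a)%Z -> (p%:Z ^+ (2 * k) %| b - a)%Z ->
  exists2 u : int, (p%:Z ^+ k %| u - 1)%Z & (p%:Z ^+ N %| b - a * u ^+ n)%Z.
Proof.
move=> p_pr k0 Dn pn' /dvdnP[C DC] pa pab.
(* The induction runs modulo [p^(N+2k)]: as [p^k] divides [n], a correction of [u] by [p^(N+k)]
   changes [u^n] only at this level. *)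
suff [u u1 uN] : exists2 u : int, (p%:Z ^+ k %| u - 1)%Z &
    (p%:Z ^+ N * (p%:Z ^+ k) ^+ 2 %| b - a * u ^+ n)%Z.
  by exists u => //; apply: dvdz_trans uN; apply: dvdz_mulr.
have Q1 : p%:Z ^+ k = p%:Z * p%:Z ^+ k.-1 by rewrite -exprS prednK.
have DnR : n%:R = p%:Z ^+ k * n'%:R by rewrite Dn natrM natrX !natz.
have DCR : 'C(n, 2)%:R = C%:R * p%:Z :> int by rewrite DC natrM !natz.
elim: N => [|N [u u1 /dvdzP[c Dc]]].
  by exists 1; rewrite ?subrr ?dvdz0 // expr1n mulr1 expr0 mul1r -exprM mulnC.
have cop_u : coprimez p u.
  have /dvdzP[e De] : (p%:Z %| u - 1)%Z.
    by apply: dvdz_trans u1; rewrite Q1 dvdz_mulr.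
  by apply/coprimezP; exists (- e, 1) => /=; rewrite -[u](subrK 1) De; ring.
(* Here [y] inverts [a u^n n'] modulo [p], so the linear term of the correction by [p^(N+k) c y]
   cancels the error [c p^(N+2k)] modulo one more power of [p]. *)
have /coprimezP[[x y] /= Bez] : coprimez p (a * u ^+ n * n'%:R).
  rewrite !coprimezMr coprimezXr // andbT natz !coprimezE absz_nat.
  by rewrite !prime_coprime // pn' andbT -[p in (p %| _)%N]absz_nat -dvdzE.
have [z Dz] := expr1D_cubic (p%:Z ^+ N * p%:Z ^+ k * (c * y)) n.
exists (u * (1 + p%:Z ^+ N * p%:Z ^+ k * (c * y))).
  rewrite mulrDr mulr1 addrAC rpredD // [X in (_ %| _ * X)%Z]mulrAC.
  by rewrite !dvdz_mull.
apply/dvdzP; exists (c * x - a * u ^+ n *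
  (C%:R * p%:Z ^+ N * (c * y) ^+ 2
   + z * (p%:Z ^+ N) ^+ 2 * p%:Z ^+ k.-1 * (c * y) ^+ 3)).
rewrite exprMn Dz DnR DCR (exprS _ N).
have -> : b = a * u ^+ n + c * (p%:Z ^+ N * (p%:Z ^+ k) ^+ 2) by rewrite -Dc subrKC.
move: Bez Q1; set A := p%:Z ^+ N; set Q := p%:Z ^+ k; set Q' := p%:Z ^+ k.-1.
set U := u ^+ n => Bez Q1; apply/eqP; rewrite -subr_eq0; apply/eqP.
transitivity (c * A * Q ^+ 2 * (1 - (x * p%:Z + y * (a * U * n'%:R)))
  - a * U * z * A ^+ 3 * (c * y) ^+ 3 * Q ^+ 2 * (Q - p%:Z * Q')); first by ring.
by rewrite Bez -Q1 !subrr !mulr0 subrr.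
Qed.

Lemma Aint_root_monic (p : {poly algC}) x :
  p \is monic -> root p x -> (forall i, p`_i \in Aint) -> x \in Aint.
Proof.
move=> p_mon px pA; apply/AintP; apply: integral_root_monic p_mon px _.
by apply/integral_poly => i; apply/AintP.
Qed.

Lemma dvdz_coef_scale (q : int) (F : {poly int}) :
  (forall i, (q %| F`_i)%Z) ->
  exists2 F' : {poly int}, F = q *: F' & (size F' <= size F)%N.
Proof.
move=> qF; exists (\poly_(i < size F) (F`_i %/ q)%Z); last exact: size_poly.
apply/polyP => i; rewrite coefZ coef_poly; case: ltnP => [_|szF].
  by rewrite mulrC divzK.
by rewrite nth_default // mulr0.
Qed.

Lemma Aint_horner_dvdz (q : int) (F : {poly int}) x :
    q != 0 -> (forall i, (q %| F`_i)%Z) -> x \in Aint ->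
  (map_poly intr F).[x] / q%:~R \in Aint.
Proof.
move=> q0 /dvdz_coef_scale[F' -> _] xA.
by rewrite map_polyZ hornerZ mulrAC mulfV ?intr_eq0 // mul1r Aint_horner_int.
Qed.

Lemma int_binomial_edivp n (m : int) (G : {poly int}) : (0 < n)%N ->
  exists h R, G = h * ('X^n - m%:P) + R /\ (size R <= n)%N.
Proof.
move=> n0; have B_mon := monicXnsubC m n0.
exists (Pdiv.Ring.rdivp G ('X^n - m%:P)), (Pdiv.Ring.rmodp G ('X^n - m%:P)).
split; first exact: Pdiv.RingMonic.rdivp_eq.
rewrite -ltnS -(size_XnsubC m n0) Pdiv.Ring.ltn_rmodp.
by rewrite -size_poly_eq0 size_XnsubC.
Qed.

(** The remainder of the division by the monic binomial has degree below [n] and vanishes at [r], so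
    irreducibility makes it zero. *)
Lemma int_binomial_factor n m (r : algC) (G : {poly int}) :
    (0 < n)%N -> radicand m -> r ^+ n = m%:~R ->
  (map_poly intr G).[r] = 0 -> exists h, G = h * ('X^n - m%:P).
Proof.
move=> n0 mP rn; have [h [R [-> szR]]] := int_binomial_edivp m G n0.
rewrite rmorphD rmorphM rmorphB /= map_polyXn map_polyC /= !hornerE rn.
rewrite subrr mulr0 add0r.
move/eqP; rewrite -map_intr_ratr -/(root _ _) (root_binomial_dvdp _ _ n0 mP rn).
have [-> _ | R0] := eqVneq R 0; first by exists h; rewrite addr0.
move/dvdp_leq; rewrite map_poly_eq0_id0 ?size_XnsubC //; last first.
  by rewrite intr_eq0 lead_coef_eq0.
rewrite R0 size_map_inj_poly ?rmorph0 //; last exact: intr_inj.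
by move=> /(_ isT); rewrite ltnNge szR.
Qed.

(** Let [g], monic of degree [d], kill [F(r) / q]. Then [G = q^d g(F / q)] is an integer multiple
    [h * (X^n - m)]. At [s] this reads [q^d g(y) = h(s) (m1 - m)] for [y = F(s) / q], so [g(y)] is
    an algebraic integer [e], and [y] is a root of [g - e]. *)
Lemma Aint_horner_near n m (r : algC) (q : int) (F : {poly int}) :
    (0 < n)%N -> radicand m -> r ^+ n = m%:~R -> q != 0 ->
    (map_poly intr F).[r] / q%:~R \in Aint ->
  exists d, forall m1 (s : algC), s ^+ n = m1%:~R -> (q ^+ d %| m1 - m)%Z ->
    (map_poly intr F).[s] / q%:~R \in Aint.
Proof.
move=> n0 mP rn q0 /AintP[g g_mon g_root].
have qC0 : q%:~R != 0 :> algC by rewrite intr_eq0.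
have szg : size g = (size g).-1.+1 by rewrite prednK ?size_poly_gt0 ?monic_neq0.
set d := (size g).-1 in szg; exists d => m1 s sn m1m.
pose G := \sum_(i < d.+1) (g`_i * q ^+ (d - i)) *: F ^+ i.
have GE x : (map_poly intr G).[x]
    = q%:~R ^+ d * (map_poly intr g).[(map_poly intr F).[x] / q%:~R] :> algC.
  have szg' : (size (map_poly intr g : {poly algC}) <= d.+1)%N.
    by rewrite -szg size_poly.
  rewrite (horner_coef_wide _ szg') /G rmorph_sum /= horner_sum.
  rewrite mulr_sumr; apply: eq_bigr => i _.
  rewrite map_polyZ hornerZ coef_map rmorphM !rmorphXn /= horner_exp expr_div_n.
  have -> : q%:~R ^+ d = q%:~R ^+ (d - i) * q%:~R ^+ i :> algC.
    by rewrite -exprD subnK // leq_ord.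
  by field; rewrite expf_neq0.
have [h DG] : exists h, G = h * ('X^n - m%:P).
  by apply: int_binomial_factor n0 mP rn _; rewrite GE (rootP g_root) mulr0.
have /dvdzP[c Dc] := m1m.
set y := _ / _.
have gy : (map_poly intr g).[y] = (c%:~R : algC) * (map_poly intr h).[s].
  apply: (@mulfI _ (q%:~R ^+ d)); first by rewrite expf_neq0.
  rewrite -GE DG rmorphM rmorphB /= map_polyXn map_polyC /= !hornerE sn -rmorphB Dc.
  by rewrite rmorphM rmorphXn /=; ring.
(* A positive degree ensures that [g - e] is still monic. *)
have d0 : (0 < d)%N.
  rewrite lt0n; apply/eqP => d0; move/rootP: g_root.
  have /size_poly1P[a a0 Dg] : size g == 1%N by rewrite szg d0.
  by rewrite Dg map_polyC hornerC /= => /eqP; rewrite intr_eq0 (negPf a0).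
set e := (X in _ = X) in gy.
have eA : e \in Aint.
  rewrite rpredM ?Aint_int // Aint_horner_int //; exact: Aint_expn_int n0 sn.
have sz_e : (size (- e%:P) < size (map_poly intr g : {poly algC}))%N.
  rewrite size_polyN (leq_ltn_trans (size_polyC_leq1 _)) //.
  by rewrite size_map_inj_poly ?rmorph0 ?szg //; apply: intr_inj.
apply: (@Aint_root_monic (map_poly intr g - e%:P)).
- by rewrite monicE lead_coefDl // -monicE monic_map.
- by rewrite /root !hornerE gy subrr.
move=> i; rewrite coefB coef_map coefC /= rpredB ?Aint_int //.
by case: ifP.
Qed.

Lemma Aint_horner_congr n' n p k m m' (r s : algC) (F : {poly int}) :
    prime p -> (0 < k)%N -> n = (p ^ k * n')%N -> ~~ (p %| n')%N ->
    (p %| 'C(n, 2))%N -> radicand m -> ~~ (p %| m')%Z ->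
    (p%:Z ^+ (2 * k) %| m - m')%Z -> r ^+ n = m%:~R -> s ^+ n = m'%:~R ->
    (map_poly intr F).[r] / (p%:Z ^+ k)%:~R \in Aint ->
  (map_poly intr F).[s] / (p%:Z ^+ k)%:~R \in Aint.
Proof.
move=> p_pr k0 Dn pn' pC mP pm' mm' rn sn FA.
have n0 : (0 < n)%N.
  by rewrite Dn muln_gt0 expn_gt0 prime_gt0 //= lt0n; apply: contraNneq pn' => ->.
have q0 : p%:Z ^+ k != 0.
  by rewrite expf_neq0 //; case: p p_pr {Dn pn' pC pm' mm' FA}.
have [d near] := Aint_horner_near n0 mP rn q0 FA.
(* The precision [k * d] matches the modulus [(p^k)^d] required by [near]. *)
have [v v1 vN] := expn_lift (k * d) p_pr k0 Dn pn' pC pm' mm'.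
have sA : s \in Aint := Aint_expn_int n0 sn.
have : (map_poly intr F).[v%:~R * s] / (p%:Z ^+ k)%:~R \in Aint.
  apply: (near (m' * v ^+ n)); first by rewrite exprMn sn rmorphM rmorphXn /= mulrC.
  by rewrite -exprM -rpredN opprB.
(* [D(s) = F(v s) - F(s)], and [p^k] divides [D] because it divides [v - 1]. *)
pose D := \poly_(i < size F) (F`_i * (v ^+ i - 1)).
have -> : (map_poly intr F).[v%:~R * s]
    = (map_poly intr F).[s] + (map_poly intr D).[s] :> algC.
  have szD : (size (map_poly intr D : {poly algC}) <= size F)%N.
    exact: leq_trans (size_poly _ _) (size_poly _ _).
  have szF : (size (map_poly intr F : {poly algC}) <= size F)%N by apply: size_poly.
  rewrite (horner_coef_wide _ szD) !(horner_coef_wide _ szF) -big_split /=.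
  apply: eq_bigr => i _; rewrite !coef_map coef_poly ltn_ord exprMn /=.
  by rewrite rmorphM rmorphB rmorphXn /=; ring.
rewrite mulrDl rpredDr // Aint_horner_dvdz // => i.
rewrite coef_poly; case: ifP => _; last exact: dvdz0.
by rewrite dvdz_mull // subrX1 dvdz_mulr.
Qed.

(** * Primes dividing the radicand, and the prime 2 *)

(** Powers of [p] are removed one at a time: if [F = p^k F1] and [m = e p], then
    [F1(r) / p = e F1(r) / m] is integral, so [m] divides [e F1] and [p] divides [F1]. *)
Lemma dvdz_coef_prime_power n m p k (r : algC) (F : {poly int}) :
    prime p -> radicand m -> (p %| m)%Z -> r ^+ n = m%:~R -> (size F <= n)%N ->
    (map_poly intr F).[r] / (p%:Z ^+ k)%:~R \in Aint ->
  forall i, (p%:Z ^+ k %| F`_i)%Z.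
Proof.
move=> p_pr mP /dvdzP[e De] rn; elim: k F => [|k IH] F szF FA i.
  by rewrite expr0 dvd1z.
have P0 : p%:Z != 0 by case: p p_pr {De FA IH}.
have PC0 : p%:Z%:~R != 0 :> algC by rewrite intr_eq0.
have PkC0 : (p%:Z ^+ k)%:~R != 0 :> algC by rewrite intr_eq0 expf_neq0.
have /dvdz_coef_scale[F1 DF szF1] : forall i, (p%:Z ^+ k %| F`_i)%Z.
  apply: IH => //; move: FA; rewrite exprSr rmorphM /= invfM mulrA.
  by move=> /rpredM/(_ (Aint_int p%:Z)); rewrite divfK.
have m0 := radicand_neq0 mP.
have e0 : e != 0 by apply: contraNneq m0 => e0; rewrite De e0 mul0r.
rewrite DF coefZ exprSr dvdz_mul // -(dvdz_mul2l e0) -De -coefZ.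
apply: dvdz_coef_radicand mP rn _ _; first by rewrite size_scale ?(leq_trans szF1).
move: FA; rewrite DF exprSr De !map_polyZ !hornerZ !rmorphM /=.
congr (_ \in Aint); field.
by rewrite PC0 PkC0 intr_eq0 e0.
Qed.

(** [F(s) / 2] and [F(- s) / 2] have sum [E(s^2)] and product [H(s^2) / 4]; once the product is
    integral, both are roots of a monic quadratic with integral coefficients. *)
Lemma Aint_horner_half n' m m' (r s : algC) (F : {poly int}) :
    odd n' -> radicand m -> (4 %| m' - m)%Z ->
    r ^+ (2 * n') = m%:~R -> s ^+ (2 * n') = m'%:~R ->
    (map_poly intr F).[r] / 2%:~R \in Aint ->
  (map_poly intr F).[s] / 2%:~R \in Aint.
Proof.
move=> n'_odd mP /dvdzP[c Dc] rn sn FA; have n'0 : (0 < n')%N := odd_gt0 n'_odd.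
have sA : s \in Aint by apply: Aint_expn_int sn; rewrite muln_gt0.
pose E := even_poly F; pose O := odd_poly F; pose H := E ^+ 2 - 'X * O ^+ 2.
have FE x : (map_poly intr F).[x]
    = (map_poly intr E).[x ^+ 2] + (map_poly intr O).[x ^+ 2] * x :> algC.
  rewrite -{1}(poly_even_odd F) rmorphD rmorphM /= !map_comp_poly /=.
  rewrite map_polyXn map_polyX.
  by rewrite !hornerE !horner_comp !hornerE.
have HE x : (map_poly intr H).[x ^+ 2]
    = (map_poly intr F).[x] * (map_poly intr F).[- x] :> algC.
  rewrite !FE sqrrN /H rmorphB rmorphXn rmorphM rmorphXn /= map_polyX.
  by rewrite !(hornerE, horner_exp) /=; ring.
(* [- r] is a conjugate of [r], the exponent [2 n'] being even. *)
have FNA : (map_poly intr F).[- r] / 2%:~R \in Aint.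
  have FZ x : (map_poly intr F).[x] / 2%:~R
      = (map_poly ratr (2%:~R^-1 *: map_poly intr F : {poly rat})).[x] :> algC.
    by rewrite map_polyZ hornerZ map_intr_ratr fmorphV rmorph_int mulrC.
  rewrite FZ; apply: (@Aint_conjugate (2 * n') m r) => //; last first.
  - by rewrite -FZ.
  - by rewrite exprM sqrrN -exprM.
  by rewrite muln_gt0.
have [h [R [DH szR]]] := int_binomial_edivp m H n'0.
have HR x m1 : x ^+ (2 * n') = m1%:~R -> (map_poly intr H).[x ^+ 2]
    = (map_poly intr h).[x ^+ 2] * (m1 - m)%:~R
      + (map_poly intr R).[x ^+ 2] :> algC.
  move=> xn; rewrite DH rmorphD rmorphM rmorphB /= map_polyXn map_polyC /=.
  by rewrite !hornerE -exprM xn rmorphB.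
(* [R(r^2) / 4] is the product of [F(r) / 2] and [F(- r) / 2]. As [r^2] is an [n']-th root of [m],
   the coefficients of [R / 4] have denominators dividing [n'], which is odd. *)
have R4 i : (4 %| R`_i)%Z.
  have szR' : (size (4%:~R^-1 *: map_poly intr R : {poly rat}) <= n')%N.
    by rewrite (leq_trans (size_scale_leq _ _)) // (leq_trans (size_poly _ _)).
  have : n'%:R *: (4%:~R^-1 *: map_poly intr R : {poly rat}) \is a polyOver Num.int.
    apply: (Aint_binomial_denominator n'0 mP _ szR' (r := r ^+ 2)).
      by rewrite -exprM.
    rewrite map_polyZ hornerZ map_intr_ratr fmorphV rmorph_int.
    have -> : (map_poly intr R).[r ^+ 2]
        = (map_poly intr F).[r] * (map_poly intr F).[- r] :> algC.
      by rewrite -HE (HR _ _ rn) subrr mulr0 add0r.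
    have -> : 4%:~R = 2%:~R * 2%:~R :> algC by rewrite -rmorphM.
    by rewrite invfM mulrC mulrACA rpredM.
  move/polyOverP/(_ i)/intrP => [b]; rewrite !coefZ coef_map /= => Db.
  have : (4 %| R`_i * n'%:Z)%Z.
    apply/dvdzP; exists b; apply: (@intr_inj rat); rewrite !rmorphM /= -Db.
    by rewrite -pmulrn; field.
  have cop4 : coprime (2 ^ 2) n' by rewrite coprimeXl // coprime2n.
  by rewrite Gauss_dvdzl // coprimezE.
set y := _ / _; pose y' := (map_poly intr F).[- s] / 2%:~R.
apply: (@Aint_root_monic (('X - y%:P) * ('X - y'%:P))).
- by rewrite monicMl monicXsubC.
- by rewrite rootM root_XsubC eqxx.
have yD : y + y' = (map_poly intr E).[s ^+ 2].
  by rewrite /y /y' !FE sqrrN; field.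
have yM : y * y' \in Aint.
  have -> : y * y' = (map_poly intr H).[s ^+ 2] / 4%:~R.
    by rewrite HE /y /y'; field.
  rewrite (HR _ _ sn) mulrDl Dc rmorphM /= mulrA mulfK ?intr_eq0 //.
  apply: rpredD; first by rewrite rpredM ?Aint_int ?Aint_horner_int ?rpredX.
  by apply: Aint_horner_dvdz; rewrite ?rpredX.
have quad (a b : algC) :
    ('X - a%:P) * ('X - b%:P) = 'X^2 - (a + b) *: 'X + (a * b)%:P.
  by rewrite -mul_polyC polyCM polyCD; ring.
move=> i; rewrite quad coefD coefB coefXn coefZ coefX coefC.
rewrite rpredD ?rpredB ?rpredM ?rpred_nat //; last by case: ifP.
by rewrite yD Aint_horner_int ?rpredX.
Qed.

(** * Gluing the prime powers dividing the degree *)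

Lemma Aint_div_coprime a b (x : algC) :
    (0 < a)%N -> (0 < b)%N -> coprime a b ->
    x / a%:R \in Aint -> x / b%:R \in Aint ->
  x / (a * b)%:R \in Aint.
Proof.
move=> a0 b0 cop xa xb.
have /coprimezP[[u v] /= Bez] : coprimez a b by rewrite coprimezE.
have -> : x / (a * b)%:R = u%:~R * (x / b%:R) + v%:~R * (x / a%:R).
  have BezC : u%:~R * a%:R + v%:~R * b%:R = 1 :> algC.
    by rewrite !pmulrn -!rmorphM -rmorphD /= Bez.
  transitivity ((u%:~R * a%:R + v%:~R * b%:R) * x / (a * b)%:R).
    by rewrite BezC mul1r.
  rewrite natrM; field.
  by rewrite !pnatr_eq0 -!lt0n a0 b0.
by apply: rpredD; apply: rpredM; rewrite ?Aint_int.
Qed.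

Lemma partn_ind (P : nat -> Prop) n :
    (0 < n)%N -> P 1%N ->
    (forall a b, (0 < a)%N -> (0 < b)%N -> coprime a b ->
      P a -> P b -> P (a * b)%N) ->
    (forall p, prime p -> (p %| n)%N -> P (n`_p)%N) ->
  P n.
Proof.
move=> n0 P1 PM; elim/ltn_ind: n n0 => n IH n0 Pp.
have [n1|n1] := leqP n 1; first by have -> : n = 1%N by lia.
have p_pr := pdiv_prime n1; set p := pdiv n in p_pr.
rewrite -(partnC p n0); apply: PM; rewrite ?part_gt0 ?coprime_partC //.
  by apply: Pp; rewrite ?pdiv_dvd.
apply: IH; rewrite ?part_gt0 //.
  have := partnC p n0; have := part_gt0 p^' n; have : (1 < n`_p)%N.
    rewrite p_part -(expn0 p) ltn_exp2l ?prime_gt1 // logn_gt0.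
    by rewrite mem_primes p_pr n0 pdiv_dvd.
  by nia.
move=> l l_pr l_n; have lp : l != p.
  apply/eqP => lp; rewrite lp in l_n.
  by have := part_pnat p^' n; rewrite p'natE // l_n.
rewrite partn_part; last by move=> x; rewrite !inE => /eqP ->.
by apply: Pp => //; apply: dvdn_trans l_n (dvdn_part _ _).
Qed.

(** From [2 'C(n, 2) = n (n - 1)]: an odd [p] can be cancelled against the [2], while for [p = 2] a
    second factor [2] of [n] is left. *)
Lemma prime_dvd_bin2 p n :
  prime p -> (p %| n)%N -> (2 < p)%N || (4 %| n)%N -> (p %| 'C(n, 2))%N.
Proof.
move=> p_pr /dvdnP[c Dn]; have E : ('C(n, 2) * 2 = n * n.-1)%N.
  rewrite bin2 muln2; have := odd_double_half (n * n.-1).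
  suff -> : odd (n * n.-1) = false by [].
  by rewrite oddM; case: (n) => //= l; rewrite andNb.
have [p2 _|] := ltnP 2 p.
  have : (p %| 'C(n, 2) * 2)%N by rewrite E Dn -mulnA mulnCA dvdn_mulr.
  by rewrite Gauss_dvdl // prime_coprime // gtnNdvd.
move=> p_le2 /= /dvdnP[e De]; have -> : p = 2%N by have := prime_gt1 p_pr; lia.
apply/dvdnP; exists (e * n.-1)%N; move: E; rewrite {2}De; nia.
Qed.

Lemma Aint_horner_transfer n m m' (r s : algC) (F : {poly int}) :
    (0 < n)%N -> radicand m -> (n%:Z ^+ 2 %| m - m')%Z ->
    r ^+ n = m%:~R -> s ^+ n = m'%:~R -> (size F <= n)%N ->
    (map_poly intr F).[r] / n%:R \in Aint ->
  (map_poly intr F).[s] / n%:R \in Aint.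
Proof.
move=> n0 mP mm' rn sn szF FA; have sA : s \in Aint := Aint_expn_int n0 sn.
apply: (@partn_ind (fun d => (map_poly intr F).[s] / d%:R \in Aint)) => //.
- by rewrite divr1 Aint_horner_int.
- by move=> a b a0 b0 cop; apply: Aint_div_coprime.
move=> p p_pr p_n; rewrite p_part; set k := logn p n.
have k0 : (0 < k)%N by rewrite logn_gt0 mem_primes p_pr n0.
pose n' := (n`_p^')%N; have Dn : n = (p ^ k * n')%N by rewrite -p_part partnC.
have pn' : ~~ (p %| n')%N by rewrite -p'natE ?part_pnat.
have natE : (p ^ k)%:R = (p%:Z ^+ k)%:~R :> algC by rewrite natrX rmorphXn.
have q0 : (p ^ k)%:R != 0 :> algC by rewrite pnatr_eq0 -lt0n expn_gt0 prime_gt0.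
have qZ0 : p%:Z ^+ k != 0 by rewrite expf_neq0 //; case: (p) p_pr.
have n'C0 : n'%:R != 0 :> algC by rewrite pnatr_eq0 -lt0n part_gt0.
have{FA} FA : (map_poly intr F).[r] / (p%:Z ^+ k)%:~R \in Aint.
  have -> : (map_poly intr F).[r] / (p%:Z ^+ k)%:~R
      = n'%:R * ((map_poly intr F).[r] / n%:R) :> algC.
    by rewrite [in RHS]Dn natrM -natE; field; rewrite q0 n'C0.
  by rewrite rpredM // rpred_nat.
(* The congruence modulo [n^2] gives exactly the precision [2k] from which the lifting starts. *)
have mm'p : (p%:Z ^+ (2 * k) %| m - m')%Z.
  apply: dvdz_trans mm'; rewrite mulnC exprM dvdz_exp2r //.
  by rewrite Dn PoszM -natz natrX natz dvdz_mulr.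
have pmm' : (p %| m - m')%Z.
  by apply: dvdz_trans mm'p; rewrite dvdz_exp // muln_gt0.
rewrite natE; have [pm|pm] := boolP (p %| m)%Z.
  apply: Aint_horner_dvdz => //.
  exact: dvdz_coef_prime_power p_pr mP pm rn szF FA.
have [pC|pC] := boolP (p %| 'C(n, 2))%N.
  apply: Aint_horner_congr p_pr k0 Dn pn' pC mP _ mm'p rn sn FA.
  by apply: contra pm => pm'; rewrite -[m](subrK m') rpredD.
(* Only [p^k = 2] remains, since [p] would divide ['C(n, 2)] if it were odd or if [4] divided
   [n]. *)
have p2 : p = 2%N.
  apply/eqP; rewrite eqn_leq prime_gt1 // andbT leqNgt; apply: contra pC => p2.
  by rewrite prime_dvd_bin2 // p2.
have k1 : k = 1%N.
  apply/eqP; rewrite eqn_leq k0 andbT leqNgt; apply: contra pC => k2.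
  by rewrite prime_dvd_bin2 // -[4%N]/(2 ^ 2)%N Dn p2 dvdn_mulr ?orbT // dvdn_exp2l.
move: FA mm'p; rewrite k1 p2 expr1 => FA mm'4.
apply: (@Aint_horner_half n' m m' r) => //.
- by move: pn'; rewrite p2 dvdn2 negbK.
- by rewrite -rpredN opprB.
- by rewrite -rn Dn k1 p2.
- by rewrite -sn Dn k1 p2.
Qed.

(** * Transfer between number fields and integral bases *)

(** Complex roots [r] and [s] stand in for [theta] and [gamma]; integrality of [f(r)] gives
    [f = F / n] with [F] integral, the shape to which the prime-by-prime comparison applies. *)
Lemma integral_horner_transfer (L L' : fieldExtType rat) (theta : L)
    (gamma : L') n m m' (f : {poly rat}) :
    (0 < n)%N -> radicand m -> radicand m' -> (n%:Z ^+ 2 %| m - m')%Z ->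
    theta ^+ n = m%:~R -> gamma ^+ n = m'%:~R -> (size f <= n)%N ->
    integralOver intr (map_poly (in_alg L) f).[theta] ->
  integralOver intr (map_poly (in_alg L') f).[gamma].
Proof.
move=> n0 mP m'P mm' tn gn szf fI.
pose r : algC := n.-root m%:~R; have rn : r ^+ n = m%:~R by apply: rootCK.
pose s : algC := n.-root m'%:~R; have sn : s ^+ n = m'%:~R by apply: rootCK.
apply: (integral_horner_binomial (iota := ratr) _ n0 m'P sn gn).
have /AintP frA := integral_horner_binomial (ratr : rat -> algC) n0 mP tn rn fI.
apply/AintP; have /floorpP[F DF] := Aint_binomial_denominator n0 mP rn szf frA.
have nC0 : n%:R != 0 :> algC by rewrite pnatr_eq0 -lt0n.
have FE x : (map_poly ratr f).[x] = (map_poly intr F).[x] / n%:R :> algC.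
  by rewrite -map_intr_ratr -DF map_polyZ hornerZ rmorph_nat mulrAC mulfV // mul1r.
rewrite FE; apply: Aint_horner_transfer n0 mP mm' rn sn _ _; last first.
  by rewrite -FE.
rewrite -(size_map_inj_poly (@intr_inj rat)) ?rmorph0 // -DF.
exact: leq_trans (size_scale_leq _ _) szf.
Qed.

Lemma horner_binomial_inj (L : fieldExtType rat) (theta : L) n m
    (f g : {poly rat}) :
    (0 < n)%N -> radicand m -> theta ^+ n = m%:~R ->
    (size f <= n)%N -> (size g <= n)%N ->
  (map_poly (in_alg L) f).[theta] = (map_poly (in_alg L) g).[theta] -> f = g.
Proof.
move=> n0 mP tn szf szg fg; apply/eqP; rewrite -subr_eq0.
have : root (map_poly (in_alg L) (f - g)) theta.
  by rewrite /root rmorphB hornerD hornerN fg subrr.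
rewrite (root_binomial_dvdp _ _ n0 mP tn).
have [//|fg0] := eqVneq (f - g) 0; move/dvdp_leq => /(_ fg0).
rewrite size_XnsubC // ltnNge (leq_trans (size_polyD _ _)) //.
by rewrite size_polyN geq_max szf.
Qed.

Lemma horner_binomial_surj (L : fieldExtType rat) (theta x : L) n m :
    (0 < n)%N -> theta ^+ n = m%:~R -> <<1; theta>>%VS = fullv ->
  exists2 f : {poly rat}, (size f <= n)%N & x = (map_poly (in_alg L) f).[theta].
Proof.
move=> n0 tn full; have : x \in <<1; theta>>%VS by rewrite full memvf.
case/Fadjoin_polyP => p /polyOver1P[f0 ->] ->.
set B : {poly rat} := 'X^n - m%:~R%:P.
exists (f0 %% B).
  rewrite -ltnS -(size_XnsubC (m%:~R : rat) n0) ltn_modp.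
  by rewrite -size_poly_eq0 size_XnsubC.
rewrite {1}(divp_eq f0 B) rmorphD rmorphM /= hornerD hornerM.
by rewrite (rootP (root_binomial _ tn)) mulr0 add0r.
Qed.

(** The candidates in both fields are values of this one rational polynomial. *)
Definition candidate_poly n (a : 'I_n -> 'I_n -> int) (q : 'I_n -> nat)
    (j : 'I_n) : {poly rat} :=
  (q j)%:R^-1 *: \sum_(i < n) (a j i)%:~R *: 'X^i.

Lemma size_candidate_poly n (a : 'I_n -> 'I_n -> int) q j :
  (size (candidate_poly a q j) <= n)%N.
Proof.
apply: leq_trans (size_scale_leq _ _) _; apply: (leq_trans (size_sum _ _ _)).
apply/bigmax_leqP => i _; apply: leq_trans (size_scale_leq _ _) _.
by rewrite size_polyXn.
Qed.

Lemma basis_candidateE (L : fieldExtType rat) n (a : 'I_n -> 'I_n -> int) q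
    (t : L) j :
  basis_candidate a q t j = (map_poly (in_alg L) (candidate_poly a q j)).[t].
Proof.
rewrite /candidate_poly map_polyZ hornerZ fmorphV rmorph_nat; congr (_ * _).
rewrite rmorph_sum horner_sum; apply: eq_bigr => i _.
by rewrite /= map_polyZ map_polyXn hornerZ hornerXn rmorph_int.
Qed.

Lemma sum_basis_candidateE (L : fieldExtType rat) n (a : 'I_n -> 'I_n -> int) q
    (t : L) (c : 'I_n -> int) :
  \sum_(j < n) (c j)%:~R * basis_candidate a q t j
  = (map_poly (in_alg L) (\sum_(j < n) (c j)%:~R *: candidate_poly a q j)).[t].
Proof.
rewrite rmorph_sum horner_sum; apply: eq_bigr => j _.
by rewrite /= map_polyZ hornerZ rmorph_int basis_candidateE.
Qed.

Lemma size_sum_candidate_poly n (a : 'I_n -> 'I_n -> int) q (c : 'I_n -> int) :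
  (size (\sum_(j < n) (c j)%:~R *: candidate_poly a q j)%R <= n)%N.
Proof.
apply: (leq_trans (size_sum _ _ _)); apply/bigmax_leqP => j _.
exact: leq_trans (size_scale_leq _ _) (size_candidate_poly _ _ _).
Qed.

(** Linear relations are identities between polynomials of degree below [n], so they pass between
    [theta] and [gamma]. For spanning, an integral [x = f(gamma)] is moved back to [f(theta)],
    expanded there, and the same coefficients work for [x]. *)
Lemma integral_basis_transfer (L L' : fieldExtType rat) (theta : L)
    (gamma : L') n m m' (a : 'I_n -> 'I_n -> int) (q : 'I_n -> nat) :
    (0 < n)%N -> radicand m -> radicand m' -> (n%:Z ^+ 2 %| m - m')%Z ->
    theta ^+ n = m%:~R -> gamma ^+ n = m'%:~R -> <<1; gamma>>%VS = fullv ->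
  integral_basis (basis_candidate a q theta) ->
  integral_basis (basis_candidate a q gamma).
Proof.
move=> n0 mP m'P mm' tn gn full [wI wfree wspan].
have m'm : (n%:Z ^+ 2 %| m' - m)%Z by rewrite -rpredN opprB.
split=> [j | c | x xI].
- move: (wI j); rewrite /ring_of_integers !basis_candidateE.
  exact: integral_horner_transfer n0 mP m'P mm' tn gn (size_candidate_poly _ _ _).
- rewrite sum_basis_candidateE => c0; apply: wfree; rewrite sum_basis_candidateE.
  suff -> : \sum_(j < n) (c j)%:~R *: candidate_poly a q j = 0.
    by rewrite rmorph0 horner0.
  apply: (horner_binomial_inj n0 m'P gn (size_sum_candidate_poly _ _ _)).
    by rewrite size_poly0.
  by rewrite c0 rmorph0 horner0.
have [f szf Dx] := horner_binomial_surj x n0 gn full.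
have [|c Dc] := wspan (map_poly (in_alg L) f).[theta].
  apply: (integral_horner_transfer n0 m'P mP m'm gn tn szf).
  by rewrite -Dx.
exists c; rewrite Dx sum_basis_candidateE; congr (map_poly _ _).[_].
apply: (horner_binomial_inj n0 mP tn szf (size_sum_candidate_poly _ _ _)).
by rewrite Dc sum_basis_candidateE.
Qed.

Theorem theorem3 (n : nat) (m m' : int)
    (L L' : fieldExtType rat) (theta : L) (gamma : L')
    (hn : (3 <= n <= 9)%N)
    (hm0 : m <> 0) (hm1 : m <> 1) (hmN1 : m <> -1) (hm : squarefreez m)
    (hm'0 : m' <> 0) (hm'1 : m' <> 1) (hm'N1 : m' <> -1)
    (hm' : squarefreez m')
    (hmm' : (m = m' %[mod (n ^ 2)%N])%Z)
    (htheta : theta ^+ n = m%:~R) (hL : <<1; theta>>%VS = fullv)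
    (hgamma : gamma ^+ n = m'%:~R) (hL' : <<1; gamma>>%VS = fullv)
    (a : 'I_n -> 'I_n -> int) (q : 'I_n -> nat)
    (hq : forall j, (0 < q j)%N) :
  integral_basis (basis_candidate a q theta) <->
  integral_basis (basis_candidate a q gamma).
Proof.
have n0 : (0 < n)%N by case/andP: hn => /ltnW/ltnW.
have mP : radicand m by split=> //; rewrite unitzE; lia.
have m'P : radicand m' by split=> //; rewrite unitzE; lia.
have mm' : (n%:Z ^+ 2 %| m - m')%Z.
  by move/eqP: hmm'; rewrite eqz_mod_dvd -natz natrX natz.
have m'm : (n%:Z ^+ 2 %| m' - m)%Z by rewrite -rpredN opprB.
split; first exact: integral_basis_transfer mP m'P mm' htheta hgamma hL'.
exact: integral_basis_transfer m'P mP m'm hgamma htheta hL.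
Qed.
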